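(* Let $w(x,y)=x^{a_1}y^{b_1}\cdots x^{a_r}y^{b_r}$ be a reduced word with $r\ge1$ and all integers $a_i,b_j$ nonzero, such that its trace polynomial satisfies $f_w(s,u,t)=D_r(q(s,u,t))$ for some polynomial $q\in\mathbb Q[s,u,t]$. Then $w(x,y)=(x^{a_1}y^{b_1})^r$ in the free group on $x,y$.
   Context: The trace polynomial $f_w\in\mathbb Z[s,u,t]$ of a word $w$ in the free group on $x,y$ is the polynomial such that $\mathrm{tr}(w(X,Y))=f_w(\mathrm{tr}(X),\mathrm{tr}(XY),\mathrm{tr}(Y))$ for every commutative ring $k$ with $1$ and all $X,Y\in \mathrm{SL}(2,k)$. $D_n(x)$ denotes the $n$th Dickson polynomial (with parameter $1$), determined by $D_n(x+x^{-1})=x^n+x^{-n}$; equivalently $D_n(x)=2T_n(x/2)$ with $T_n$ the $n$th Chebyshev polynomial. *)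

(* Defs.v *)
From HB Require Import structures.
From mathcomp Require Import all_boot all_order all_algebra.
From mathcomp Require Import ring.
From mathcomp.multinomials Require Import mpoly.

Set Implicit Arguments.
Unset Strict Implicit.
Unset Printing Implicit Defensive.

Import GRing.Theory.

(* The free group on T is realised on the freely reduced words over the letters
   (t, b), where (t, true) stands for t and (t, false) for t^-1. *)
Section FreeGroup.
Variable T : choiceType.

Local Notation letter := (T * bool)%type.
Implicit Types (l m : letter) (s u v : seq letter).

Definition linv l : letter := (l.1, ~~ l.2).

Definition reduced s : bool := sorted (fun l m => m != linv l) s.

(* prepend a letter, cancelling it against the head if possible *)
Definition lcons l s : seq letter :=
  if s is m :: s' then if m == linv l then s' else l :: s else [:: l].

Definition fmul_seq u v : seq letter := foldr lcons v u.
Definition finv_seq u : seq letter := rev (map linv u).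

Lemma linvK : involutive linv.
Proof. by case=> t b; rewrite /linv /= negbK. Qed.

Lemma lcons_reduced l s : reduced s -> reduced (lcons l s).
Proof.
case: s => [|m s] //= Hs; case: ifP => [_|/negbT Hm].
  exact: path_sorted Hs.
by rewrite /= Hm.
Qed.

Lemma fmul_reduced u v : reduced v -> reduced (fmul_seq u v).
Proof. by move=> Hv; elim: u => //= l u; apply: lcons_reduced. Qed.

Lemma lconsK l s : reduced s -> lcons l (lcons (linv l) s) = s.
Proof.
case: s => [|m s] /= Hs; first by rewrite eqxx.
rewrite linvK; case: eqP Hs => [->|_] Hs /=; last by rewrite eqxx.
by case: s Hs => [|m' s] //= /andP[/negbTE -> _].
Qed.

Lemma fmul_lcons l u v :
  reduced v -> fmul_seq (lcons l u) v = lcons l (fmul_seq u v).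
Proof.
case: u => [|m u] //= Hv; case: ifP => // /eqP ->.
by rewrite lconsK //; apply: fmul_reduced.
Qed.

Lemma fmul_nil u : reduced u -> fmul_seq u [::] = u.
Proof.
elim: u => //= l u IHu Hu; rewrite IHu; last exact: path_sorted Hu.
by case: u Hu {IHu} => //= m u /andP[/negbTE -> _].
Qed.

Lemma finv_reduced u : reduced u -> reduced (finv_seq u).
Proof.
rewrite /reduced /finv_seq rev_sorted sorted_map.
case: u => //= l u; apply: sub_path => a b /=.
by rewrite linvK eq_sym.
Qed.

Lemma fmulK u v : reduced v -> fmul_seq u (fmul_seq (finv_seq u) v) = v.
Proof.
elim: u v => //= l u IHu v Hv.
rewrite /finv_seq /= rev_cons /fmul_seq foldr_rcons -/(finv_seq u).
rewrite -!/(fmul_seq _ _) IHu; first exact: lconsK.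
exact: lcons_reduced.
Qed.

Lemma fmul_seqA u v s :
  reduced s -> fmul_seq u (fmul_seq v s) = fmul_seq (fmul_seq u v) s.
Proof. by move=> Hs; elim: u => //= l u ->; rewrite fmul_lcons. Qed.

Lemma finv_seqK : involutive finv_seq.
Proof.
by move=> u; rewrite /finv_seq map_rev revK -map_comp map_id_in // => l _ /=;
  rewrite linvK.
Qed.

Record free_group := FreeWord { fword :> seq letter; _ : reduced fword }.
HB.instance Definition _ := [isSub for fword].
HB.instance Definition _ := [Choice of free_group by <:].

Implicit Types x y z : free_group.

Lemma fwordP x : reduced x. Proof. exact: valP. Qed.

Definition fone := @FreeWord [::] isT.
Definition fmul x y := FreeWord (fmul_reduced x (fwordP y)).
Definition finv x := FreeWord (finv_reduced (fwordP x)).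

Lemma fmulA : associative fmul.
Proof. by move=> x y z; apply/val_inj; apply/fmul_seqA/fwordP. Qed.

Lemma fmul1 : left_id fone fmul.
Proof. by move=> x; apply/val_inj. Qed.

Lemma fmulr1 : right_id fone fmul.
Proof. by move=> x; apply/val_inj/fmul_nil/fwordP. Qed.

Lemma fmulVr : right_inverse fone finv fmul.
Proof.
move=> x; apply/val_inj => /=.
by rewrite -[finv_seq _]fmul_nil ?fmulK //; apply/finv_reduced/fwordP.
Qed.

Lemma fmulVl : left_inverse fone finv fmul.
Proof.
move=> x; rewrite -[X in fmul _ X](_ : finv (finv x) = x) ?fmulVr //.
exact/val_inj/finv_seqK.
Qed.

HB.instance Definition _ :=
  isGroup.Build free_group fmulA fmul1 fmulr1 fmulVl fmulVr.

Definition fgen (t : T) : free_group := @FreeWord [:: (t, true)] isT.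

Section Eval.
Variables (G : groupType) (g : T -> G).

Definition eval_letter l : G := (if l.2 then g l.1 else (g l.1)^-1)%g.

(* the homomorphism free_group -> G extending g, i.e. substitution of the
   elements g t for the generators t *)
Definition feval (w : free_group) : G := (\prod_(l <- fword w) eval_letter l)%g.

Lemma eval_linv l : eval_letter (linv l) = (eval_letter l)^-1%g.
Proof. by case: l => t [] //=; rewrite /eval_letter /= invgK. Qed.

Lemma feval_gen t : feval (fgen t) = g t.
Proof. by rewrite /feval big_seq1. Qed.

Lemma fevalM : {morph feval : x y / (x * y)%g}.
Proof.
move=> x y; rewrite /feval /=; elim: (fword x) => [|l u IHu] /=.
  by rewrite big_nil mul1g.
rewrite big_cons -mulgA -IHu; case: (fmul_seq u y) => [|m s] /=.
  by rewrite big_seq1 big_nil mulg1.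
case: eqP => [->|_]; last by rewrite big_cons.
by rewrite big_cons eval_linv mulVKg.
Qed.

End Eval.
End FreeGroup.

Definition expgz (G : groupType) (x : G) (n : int) : G :=
  match n with Posz m => (x ^+ m)%g | Negz m => (x ^- m.+1)%g end.

Notation F2 := (free_group bool).
Definition F2x : F2 := fgen true.
Definition F2y : F2 := fgen false.

Definition eval2 (G : groupType) (X Y : G) : F2 -> G :=
  feval (fun b : bool => if b then X else Y).

Local Open Scope ring_scope.

Section SL2.
Variable k : comNzRingType.

Record SL2 := SL2Mx { SL2val :> 'M[k]_2; _ : \det SL2val == 1 }.
HB.instance Definition _ := [isSub for SL2val].
HB.instance Definition _ := [Choice of SL2 by <:].

Implicit Types X Y Z : SL2.

Lemma det_SL2 X : \det X = 1. Proof. exact/eqP/(valP X). Qed.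

Lemma SL2_one_subproof : \det (1%:M : 'M[k]_2) == 1.
Proof. by rewrite det1. Qed.

Lemma SL2_mul_subproof X Y : \det (X *m Y) == 1.
Proof. by rewrite det_mulmx !det_SL2 mulr1. Qed.

Lemma SL2_inv_subproof X : \det (\adj X) == 1.
Proof.
apply/eqP; rewrite -[LHS]mul1r -{1}(det_SL2 X) -det_mulmx mul_mx_adj.
by rewrite det_SL2 det1.
Qed.

Definition SL2_one := SL2Mx SL2_one_subproof.
Definition SL2_mul X Y := SL2Mx (SL2_mul_subproof X Y).
(* the adjugate is the inverse for determinant 1, over any commutative ring *)
Definition SL2_inv X := SL2Mx (SL2_inv_subproof X).

Lemma SL2_mulA : associative SL2_mul.
Proof. by move=> X Y Z; apply/val_inj/mulmxA. Qed.

Lemma SL2_mul1 : left_id SL2_one SL2_mul.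
Proof. by move=> X; apply/val_inj/mul1mx. Qed.

Lemma SL2_mulr1 : right_id SL2_one SL2_mul.
Proof. by move=> X; apply/val_inj/mulmx1. Qed.

Lemma SL2_mulVl : left_inverse SL2_one SL2_inv SL2_mul.
Proof. by move=> X; apply/val_inj; rewrite /= mul_adj_mx det_SL2. Qed.

Lemma SL2_mulVr : right_inverse SL2_one SL2_inv SL2_mul.
Proof. by move=> X; apply/val_inj; rewrite /= mul_mx_adj det_SL2. Qed.

HB.instance Definition _ :=
  isGroup.Build SL2 SL2_mulA SL2_mul1 SL2_mulr1 SL2_mulVl SL2_mulVr.

End SL2.

(* the variables 'X_0, 'X_1, 'X_2 are s = tr X, u = tr XY, t = tr Y *)
Definition is_trace_poly (w : F2) (f : {mpoly int[3]}) : Prop :=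
  forall (k : comNzRingType) (X Y : SL2 k),
    \tr (eval2 X Y w) =
      mmap intr (tnth [tuple \tr X; \tr (X * Y)%g; \tr Y]) f.

Section SL2Identities.
Variable k : comNzRingType.
Implicit Types A B X Y : 'M[k]_2.

Lemma adj2 A : \adj A = (\tr A)%:M - A.
Proof.
have e0 H : @Ordinal 2 0 H = 0 by apply/val_inj.
have e1 H : @Ordinal 2 1 H = 1 by apply/val_inj.
have l0 : lift (0 : 'I_2) 0 = 1 by apply/val_inj.
have l1 : lift (1 : 'I_2) 0 = 0 by apply/val_inj.
apply/matrixP=> i j; rewrite !mxE /cofactor det_mx11 !mxE.
rewrite /mxtrace !big_ord_recl big_ord0 addr0.
case: i => [[|[|//]] ?]; case: j => [[|[|//]] ?] /=;
  rewrite ?e0 ?e1 ?l0 ?l1 /= ?expr0 ?expr1 ?expr2; ring.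
Qed.

Lemma SL2_sqr (X : SL2 k) : val X *m val X = \tr X *: val X - 1%:M.
Proof.
have := mul_mx_adj X; rewrite adj2 det_SL2 mulmxBr mul_mx_scalar => <-.
by rewrite subKr.
Qed.

Lemma SL2_YX (X Y : SL2 k) : val Y *m val X =
  (\tr (X * Y)%g - \tr Y * \tr X)%:M + \tr Y *: val X + \tr X *: val Y - val X *m val Y.
Proof.
have h : (\tr (X * Y)%g)%:M - val X *m val Y =
    ((\tr Y)%:M - val Y) *m ((\tr X)%:M - val X).
  by rewrite -!adj2; exact: (congr1 val (@invgM _ X Y)).
have {}h : val Y *m val X = (\tr (X * Y)%g)%:M - val X *m val Y
    - \tr Y *: ((\tr X)%:M - val X) + val Y *m (\tr X)%:M.
  by rewrite h mulmxBl mul_scalar_mx [X in X + _]addrAC subrr add0r mulmxBr opprB subrK.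
rewrite h mul_mx_scalar; move: (\tr _) (\tr _) (\tr _) (val X *m val Y) => a b c Q.
by apply/matrixP => i j; rewrite !mxE; case: (i == j) => /=; ring.
Qed.

End SL2Identities.

Lemma trace_poly_exists w : exists f, is_trace_poly w f.
Proof.
pose ev (k : comNzRingType) (X Y : SL2 k) : {mpoly int[3]} -> k :=
  mmap intr (tnth [tuple \tr X; \tr (X * Y)%g; \tr Y]).
pose s : {mpoly int[3]} := 'X_0; pose u : {mpoly int[3]} := 'X_1.
pose t : {mpoly int[3]} := 'X_(inord 2).
have evs k (X Y : SL2 k) : ev _ X Y s = \tr X by rewrite /ev mmapX mmap1U.
have evu k (X Y : SL2 k) : ev _ X Y u = \tr (X * Y)%g by rewrite /ev mmapX mmap1U.
have evt k (X Y : SL2 k) : ev _ X Y t = \tr Y.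
  by rewrite /ev mmapX mmap1U (tnth_nth 0) /= inordK.
have evD k (X Y : SL2 k) : {morph ev _ X Y : p q / p + q} by exact: rmorphD.
have evN k (X Y : SL2 k) : {morph ev _ X Y : p / - p} by exact: rmorphN.
have evM k (X Y : SL2 k) : {morph ev _ X Y : p q / p * q} by exact: rmorphM.
suff [c0 [c1 [c2 [c3 H]]]] : exists c0 c1 c2 c3,
    forall (k : comNzRingType) (X Y : SL2 k),
    val (eval2 X Y w) = (ev _ X Y c0)%:M + ev _ X Y c1 *: val X +
     ev _ X Y c2 *: val Y + ev _ X Y c3 *: (val X *m val Y).
  exists (c0 + c0 + c1 * s + c2 * t + c3 * u) => k X Y.
  rewrite H !mxtraceD !mxtraceZ mxtrace_scalar -/(ev _ X Y _).
  by rewrite !(evD, evM) mulr2n evs evt evu.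
rewrite /eval2 /feval; elim: (fword w) => [|l v [c0 [c1 [c2 [c3 H]]]]].
  exists 1, 0, 0, 0 => k X Y; rewrite big_nil /ev rmorph1 rmorph0 !scale0r !addr0.
  by [].
have hX k (X Y : SL2 k) (M : 'M_2) d0 d1 d2 d3 :
  M = d0%:M + d1 *: val X + d2 *: val Y + d3 *: (val X *m val Y) ->
  val X *m M = (- d1)%:M + (d0 + \tr X * d1) *: val X +
    (- d3) *: val Y + (d2 + \tr X * d3) *: (val X *m val Y).
  move=> ->; rewrite !mulmxDr mul_mx_scalar -!scalemxAr mulmxA SL2_sqr.
  rewrite mulmxBl -scalemxAl mul1mx; move: (val X *m val Y) => Q.
  by apply/matrixP=> i j; rewrite !mxE; case: (i == j) => /=; ring.
have hY k (X Y : SL2 k) (M : 'M_2) d0 d1 d2 d3 :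
  M = d0%:M + d1 *: val X + d2 *: val Y + d3 *: (val X *m val Y) ->
  val Y *m M = (d1 * (\tr (X * Y)%g - \tr Y * \tr X) - d2 - d3 * \tr X)%:M +
    (d1 * \tr Y + d3) *: val X +
    (d0 + d1 * \tr X + d2 * \tr Y + d3 * \tr (X * Y)%g) *: val Y +
    (- d1) *: (val X *m val Y).
  move=> ->; rewrite !mulmxDr mul_mx_scalar -!scalemxAr mulmxA (SL2_YX X Y) (SL2_sqr Y).
  rewrite mulmxBl !mulmxDl mul_scalar_mx -!scalemxAl -mulmxA (SL2_sqr Y).
  rewrite mulmxBr mulmx1 -scalemxAr /=.
  move: (val X *m val Y) => Q.
  by apply/matrixP=> i j; rewrite !mxE; case: (i == j) => /=; ring.
case: l => [[] []].
- exists (- c1), (c0 + s * c1), (- c3), (c2 + s * c3) => k X Y.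
  rewrite big_cons /= /eval_letter /= (hX _ _ _ _ _ _ _ _ (H k X Y)).
  by rewrite !(evD, evN, evM, evs).
- exists (s * c0 + c1), (- c0), (s * c2 + c3), (- c2) => k X Y.
  rewrite big_cons /= /eval_letter /= adj2 mulmxBl.
  rewrite (hX _ _ _ _ _ _ _ _ (H k X Y)) (H k X Y) mul_scalar_mx.
  rewrite !(evD, evN, evM, evs).
  move: (val X *m val Y) => Q.
  by apply/matrixP=> i j; rewrite !mxE; case: (i == j) => /=; ring.
- exists (c1 * (u - t * s) - c2 - c3 * s), (c1 * t + c3),
    (c0 + c1 * s + c2 * t + c3 * u),
    (- c1) => k X Y.
  rewrite big_cons /= /eval_letter /= (hY _ _ _ _ _ _ _ _ (H k X Y)).
  by rewrite !(evD, evN, evM, evs, evt, evu).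
- exists (t * c0 - (c1 * (u - t * s) - c2 - c3 * s)),
    (t * c1 - (c1 * t + c3)),
    (t * c2 - (c0 + c1 * s + c2 * t + c3 * u)),
    (t * c3 + c1) => k X Y.
  rewrite big_cons /= /eval_letter /= adj2 mulmxBl.
  rewrite (hY _ _ _ _ _ _ _ _ (H k X Y)) (H k X Y) mul_scalar_mx.
  rewrite !(evD, evN, evM, evs, evt, evu).
  move: (val X *m val Y) => Q.
  by apply/matrixP=> i j; rewrite !mxE; case: (i == j) => /=; ring.
Qed.

(* over an arbitrary ring, so that (dickson A n).[a] makes sense for a : A *)
Fixpoint dickson (R : nzRingType) (n : nat) : {poly R} :=
  match n with
  | 0 => 2%:R
  | 1 => 'X
  | (m.+1 as n').+1 => 'X * dickson R n' - dickson R m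
  end.

Lemma dicksonE (F : fieldType) (n : nat) (x : F) :
  x != 0 -> (dickson F n).[x + x^-1] = x ^+ n + x ^- n.
Proof.
move=> x0; elim/ltn_ind: n => -[|[|n]] IHn; rewrite /= ?hornerE.
- by rewrite expr0 invr1.
- by rewrite expr1.
rewrite -/(dickson F n.+1) !IHn // !exprS; field.
by rewrite x0 expf_neq0.
Qed.

(* Main.v *)
Require Import Defs.
From mathcomp Require Import all_boot all_order all_algebra.
From mathcomp.multinomials Require Import mpoly.
From mathcomp Require Import monoid algC cyclotomic ring lra zify.

Import Order.TTheory GRing.Theory Num.Theory.
Local Open Scope ring_scope.

(** Write [s], [u], [t] for the traces of [X], [XY], [Y], and [U_n] for the
    Chebyshev polynomials [U_n(z + 1/z) = (z^n - z^-n) / (z - 1/z)].  By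
    Cayley-Hamilton [X^a = U_a(s) X - U_(a-1)(s)], so that, as a polynomial in
    [u], the trace polynomial of [w] has degree [r] and leading coefficient the
    product of all [U_(a_i)(s) U_(b_i)(t)] (lemmas [lead_trace_lower] and
    [lead_trace_upper], for matrices one of whose entries is [u]).  The Dickson
    polynomial [D_r] is monic of degree [r], hence [q = A u + B] is linear in
    [u], and [A^r] is that product.  The theorem follows from two consequences
    of this.

    - The absolute values of the [a_i] agree.  Take [t = 2], where
      [U_b(2) = b]: up to a constant, [A^r] is the product of the [U_(a_i)(s)].
      Let [n > 1] be the largest [|a_i|] and [z] a primitive [2n]-th root of
      unity.  Then [z + 1/z] is a simple root of [U_(a_i)] when [|a_i| = n], and not a
      root otherwise, so the number of [i] with [|a_i| = n] is a positive
      multiple of [r] (lemma [abs_eq_of_power]).  Exchanging [X] and [Y] treats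
      the [b_i].

    - The signs of the [a_i] agree, and so do those of the [b_i].  Let [E] and
      [D] be the sums of the [a_i] and of the [b_i], and take
      [s = t = z + 1/z].  The commuting pairs [Y = X] and [Y = X^-1], with [X]
      diagonal, give two values [q1], [q2] of [q] with
      [D_r(q1) = z^(E+D) + z^-(E+D)] and [D_r(q2) = z^(E-D) + z^-(E-D)].  Their
      difference is, up to sign, [A (z - 1/z)^2], whose [r]-th power is the
      product of all [(z^a_i - z^-a_i) (z^b_i - z^-b_i)] and so
      grows like [z^N] with [N] the sum of all [|a_i|] and [|b_i|].  As
      [D_r(x)] grows like [x^r], one of [|E + D|], [|E - D|] is at least [N]
      (lemma [sum_abs_le]), which forces [|E|] and [|D|] to equal the sums of
      the [|a_i|] and of the [|b_i|]. *)

(** * Dickson polynomials *)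

Lemma dickson0 (R : nzRingType) : dickson R 0 = 2%:P.
Proof. by rewrite polyC_natr. Qed.

Lemma dickson1 (R : nzRingType) : dickson R 1 = 'X.
Proof. by []. Qed.

Lemma dicksonSS (R : nzRingType) (n : nat) :
  dickson R n.+2 = 'X * dickson R n.+1 - dickson R n.
Proof. by []. Qed.

Lemma rmorph_dickson (R S : comNzRingType) (phi : {rmorphism R -> S}) n x :
  phi (dickson R n).[x] = (dickson S n).[phi x].
Proof.
elim/ltn_ind: n => -[|[|n]] IHn.
- by rewrite !dickson0 !hornerC rmorph_nat.
- by rewrite !dickson1 !hornerX.
- by rewrite !dicksonSS !(hornerD, hornerN, hornerM, hornerX) rmorphB rmorphM !IHn.
Qed.

(** The strict growth of the sizes is carried along because it keeps
    [D_n(p)] from cancelling the top term of [p D_(n+1)(p)] in the recurrence. *)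
Lemma size_lead_dickson (R : idomainType) (n : nat) (p : {poly R}) :
    (1 < size p)%N ->
  let d m := (dickson {poly R} m).[p] in
  [/\ (size (d n) < size (d n.+1))%N,
      size (d n.+1) = (n.+1 * (size p).-1).+1
    & lead_coef (d n.+1) = lead_coef p ^+ n.+1].
Proof.
move=> p_gt1 d.
have p_neq0 : p != 0 by rewrite -size_poly_eq0; case: (size p) p_gt1.
have d_rec m : d m.+2 = p * d m.+1 - d m.
  by rewrite /d dicksonSS !(hornerD, hornerN, hornerM, hornerX).
elim: n => [|n [lt_d sz_d lc_d]].
  rewrite /d dickson0 dickson1 hornerX hornerC mul1n expr1 prednK ?(ltnW p_gt1) //; split=> //.
  by apply: leq_ltn_trans p_gt1; rewrite -polyC_natr size_polyC leq_b1.
have dS_neq0 : d n.+1 != 0 by rewrite -size_poly_eq0 sz_d.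
have sz_pd : size (p * d n.+1)%R = (n.+2 * (size p).-1).+1.
  by rewrite size_mul // sz_d; lia.
have lt_pd : (size (d n.+1) < size (p * d n.+1)%R)%N by rewrite sz_pd sz_d; lia.
have lt_pd' : (size (- d n) < size (p * d n.+1)%R)%N.
  by rewrite size_polyN; apply: ltn_trans lt_pd.
rewrite d_rec size_polyDl // lead_coefDl // lead_coefM lc_d -exprS.
by split.
Qed.

(** Comparing degrees: [D_r] is monic of degree [r], so [D_r(p)] can have
    degree [r] only if [p] is linear. *)
Lemma dickson_linear (R : idomainType) (r : nat) (p : {poly R}) :
    (0 < r)%N -> size (dickson {poly R} r).[p] = r.+1 ->
  (size p <= 2)%N /\ lead_coef (dickson {poly R} r).[p] = p`_1 ^+ r.
Proof.
case: r => // r _; have [p_le1|p_gt1] := leqP (size p) 1.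
  rewrite (size1_polyC p_le1) -(rmorph_dickson _ _ polyC) => sz.
  by have := size_polyC_leq1 (dickson R r.+1).[p`_0]; rewrite sz.
have [_ -> ->] := size_lead_dickson _ r p p_gt1.
rewrite lead_coefE => /eqP; rewrite eqSS -{2}[r.+1]muln1 eqn_mul2l /= => /eqP sz_p.
by rewrite sz_p; split=> //; move: p_gt1 sz_p; case: (size p) => // [[|[|]]].
Qed.

(** From [|x| |D_(n+1)| <= |D_(n+2)| + |D_n|]: for [|x| >= 2] the sequence
    [|D_n(x)|] is nondecreasing, so each step multiplies it by at least
    [|x| - 1].  This factor is not available from [D_0 = 2] to [D_1 = x], which
    is why the induction starts with two terms. *)
Lemma dickson_lower_bound (R : realFieldType) (n : nat) (x : R) : 2 <= `|x| ->
  (`|x| - 1) ^+ n <= `|(dickson R n).[x]|.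
Proof.
move=> x_ge2; pose d m := `|(dickson R m).[x]|.
suff [_ []//] : d n <= d n.+1 /\ (`|x| - 1) ^+ n <= d n
    /\ (`|x| - 1) ^+ n.+1 <= d n.+1.
elim: n => [|n [le_d [lb_d lb_dS]]].
  by rewrite /d dickson0 dickson1 hornerX hornerC expr0 expr1 normr_nat; split; [|split]; lra.
have d_rec : `|x| * d n.+1 <= d n.+2 + d n.
  rewrite -normrM /d dicksonSS !hornerE.
  by apply: le_trans (ler_normD _ _); rewrite subrK.
have dn_ge0 : 0 <= d n by rewrite normr_ge0.
by split; [nra | split => //; rewrite exprS; nra].
Qed.

(** * Chebyshev polynomials of the second kind *)

(** The Chebyshev function of the second kind in the normalisation
    [chebU n (z + 1/z) = (z^n - z^-n) / (z - 1/z)]. *)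
Fixpoint chebU (R : nzRingType) (n : nat) (s : R) : R :=
  match n with
  | 0 => 0
  | 1 => 1
  | (m.+1 as n').+1 => s * chebU R n' s - chebU R m s
  end.
Arguments chebU {R} n s : simpl never.

(** The extension to negative indices by [U_(-n) = - U_n], which keeps the
    recurrence valid over all integers. *)
Definition chebUz (R : nzRingType) (a : int) (s : R) : R :=
  if a is Negz n then - chebU n.+1 s else chebU `|a|%N s.
Arguments chebUz {R} a s.

Section ChebU.
Variable R : comNzRingType.
Implicit Type s : R.

Lemma chebUSS n s : chebU n.+2 s = s * chebU n.+1 s - chebU n s.
Proof. by []. Qed.

Lemma rmorph_chebU (S : comNzRingType) (phi : {rmorphism R -> S}) n s :
  phi (chebU n s) = chebU n (phi s).
Proof.
elim/ltn_ind: n => -[|[|n]] IHn; rewrite ?rmorph0 ?rmorph1 //.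
by rewrite !chebUSS rmorphB rmorphM !IHn.
Qed.

Lemma rmorph_chebUz (S : comNzRingType) (phi : {rmorphism R -> S}) a s :
  phi (chebUz a s) = chebUz a (phi s).
Proof. by case: a => n; rewrite /chebUz ?rmorphN rmorph_chebU. Qed.

(** This is [det X^n = 1] in terms of [U_n] and [U_(n+1)]; it shows that
    consecutive Chebyshev values never vanish together. *)
Lemma chebU_consecutive n s :
  chebU n.+1 s ^+ 2 - s * chebU n s * chebU n.+1 s + chebU n s ^+ 2 = 1.
Proof.
elim: n => [|n IHn]; first by rewrite /chebU; ring.
by rewrite -[RHS]IHn chebUSS; ring.
Qed.

Lemma chebUz_at2 a : chebUz a 2 = a%:~R :> R.
Proof.
have U2 n : chebU n 2 = n%:R :> R.
  elim/ltn_ind: n => -[|[|n]] IHn //.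
  by rewrite chebUSS !IHn // -[n.+2%:R]natr1 -[n.+1%:R]natr1; ring.
by case: a => n; rewrite /chebUz U2 // NegzE mulrNz.
Qed.

End ChebU.

Lemma chebUz_sumV (F : fieldType) (a : int) (z : F) : z != 0 ->
  chebUz a (z + z^-1) * (z - z^-1) = z ^ a - z ^ (- a).
Proof.
move=> z_neq0.
have U n : chebU n (z + z^-1) * (z - z^-1) = z ^+ n - z ^- n.
  elim/ltn_ind: n => -[|[|n]] IHn; first by rewrite mul0r expr0 invr1 subrr.
    by rewrite mul1r expr1.
  rewrite chebUSS mulrBl -mulrA !IHn // !exprS; field.
  by rewrite z_neq0 expf_neq0.
case: a => n; rewrite /chebUz /absz; last by rewrite mulNr U NegzE opprK exprnN opprB.
by rewrite U exprnN.
Qed.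

Lemma horner_chebUX (R : comNzRingType) (n : nat) (x : R) : (chebU n 'X).[x] = chebU n x.
Proof. by rewrite -[in RHS](hornerX x); exact: (@rmorph_chebU _ _ (horner_eval x)). Qed.

Lemma chebUz_abs (R : comNzRingType) (a : int) (s : R) :
  chebUz a s = (-1) ^+ (a < 0)%R * chebU `|a|%N s.
Proof. by case: a => n; rewrite /chebUz /= ?mul1r ?mulN1r. Qed.

(** With the Dickson polynomial [D_n = 2 U_(n+1) - X U_n], these are
    [D_n' = n U_n] and [(X^2 - 4) U_n' = n D_n - X U_n], obtained by
    differentiating [D_n = z^n + z^-n] and [(z - 1/z) U_n = z^n - z^-n] in the
    variable [z + 1/z].  The induction needs both at once. *)
Lemma chebU_deriv (F : numFieldType) (n : nat) (U := fun m => chebU m ('X : {poly F})) :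
  2 * (U n.+1)^`() - U n - 'X * (U n)^`() = n%:R * U n /\
  ('X ^+ 2 - 4) * (U n)^`() = n%:R * (2 * U n.+1 - 'X * U n) - 'X * U n.
Proof.
have two_neq0 : (2 : {poly F}) != 0 by rewrite -polyC_natr polyC_eq0 pnatr_eq0.
elim: n => [|n [IH1 IH2]].
  by rewrite /U /chebU -polyC1 derivC raddf0; split; ring.
have US : U n.+2 = 'X * U n.+1 - U n by [].
have dUS : (U n.+2)^`() = U n.+1 + 'X * (U n.+1)^`() - (U n)^`().
  by rewrite US derivB derivM derivX mul1r.
have dU1 : 2 * (U n.+1)^`() = n%:R * U n + U n + 'X * (U n)^`().
  by rewrite -IH1; ring.
split; apply: (mulfI two_neq0).
  rewrite dUS; transitivity (2 * U n.+1 + 'X * (2 * (U n.+1)^`()) - 4 * (U n)^`()); first by ring.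
  rewrite dU1.
  transitivity (2 * U n.+1 + 'X * (n%:R * U n + U n) + ('X ^+ 2 - 4) * (U n)^`()).
    by ring.
  by rewrite IH2 -[n.+1%:R]natr1; ring.
transitivity (('X ^+ 2 - 4) * (2 * (U n.+1)^`())); first by ring.
rewrite dU1.
transitivity (('X ^+ 2 - 4) * (n%:R * U n + U n) + 'X * (('X ^+ 2 - 4) * (U n)^`())).
  by ring.
by rewrite IH2 US -[n.+1%:R]natr1; ring.
Qed.

(** At a root of [U_n] the differential equation reads
    [(x^2 - 4) U_n'(x) = 2 n U_(n+1)(x)], and [U_(n+1)(x)] is nonzero. *)
Lemma chebU_simple_root (F : numFieldType) (n : nat) (x : F) : (0 < n)%N ->
  root (chebU n 'X) x -> mup x (chebU n 'X) = 1%N.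
Proof.
move=> n_gt0 rUx; set p := chebU n 'X in rUx *.
have [_ /(congr1 (horner^~ x))] := chebU_deriv F n.
rewrite -/p -!polyC_natr !(hornerC, hornerD, hornerN, hornerM, hornerX) !horner_chebUX.
have Ux : chebU n x = 0 by apply/eqP; rewrite -horner_chebUX.
rewrite Ux !mulr0 !subr0 => dpx.
have dpx_neq0 : p^`().[x] != 0.
  apply/eqP => dpx0; have := chebU_consecutive F n x; move/eqP: dpx.
  rewrite dpx0 mulr0 Ux eq_sym !mulf_eq0 !pnatr_eq0 eqn0Ngt n_gt0 /= => /eqP ->.
  by move/eqP; rewrite !expr0n /= !(mulr0, mul0r) subr0 addr0 eq_sym oner_eq0.
have p_neq0 : p != 0 by apply: contraNneq dpx_neq0 => ->; rewrite deriv0 horner0.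
apply/eqP; rewrite eqn_leq mup_leq // -XsubC_dvd // dvdp_XsubCl rUx andbT.
apply: contra dpx_neq0 => /dvdpP[g ->].
rewrite expr2 !derivM derivXsubC !(hornerXsubC, hornerD, hornerM) subrr.
by rewrite !(mulr0, mul0r, addr0).
Qed.

(** * Words in two matrices *)

(** Cayley-Hamilton: the powers of [X] stay in the span of [X] and [1], with
    coefficients obeying the Chebyshev recurrence in the trace. *)
Lemma expgz_mx (R : comNzRingType) (X : SL2 R) (a : int) :
  val (expgz X a) =
    chebUz a (\tr X) *: val X - (chebUz (a - 1) (\tr X))%:M.
Proof.
have valM (A B : SL2 R) : val (A * B)%g = val A *m val B by [].
have pos n : val (X ^+ n)%g = chebU n (\tr X) *: val X - (chebUz (n%:Z - 1) (\tr X))%:M.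
  elim: n => [|n IHn].
    by apply/matrixP => i j; rewrite /= /chebUz /chebU !mxE /= mulNrn opprK mul0r add0r.
  rewrite expgS valM IHn mulmxBr -scalemxAr SL2_sqr mul_mx_scalar.
  have -> : n.+1%:Z - 1 = n by lia.
  case: n {IHn} => [|n].
    by apply/matrixP => i j; rewrite !mxE /chebUz /chebU /=; case: (i == j) => /=; ring.
  have -> : n.+1%:Z - 1 = n by lia.
  apply/matrixP => i j; rewrite !mxE /chebUz /= chebUSS.
  by case: (i == j) => /=; ring.
case: a => n; first exact: pos.
have -> : Negz n - 1 = Negz n.+1 by lia.
rewrite [val _](_ : _ = \adj (val (X ^+ n.+1)%g)) // pos.
have -> : n.+1%:Z - 1 = n by lia.
rewrite adj2 raddfB /= mxtraceZ mxtrace_scalar.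
rewrite /chebUz /= chebUSS mulr2n.
by apply/matrixP => i j; rewrite !mxE; case: (i == j) => /=; ring.
Qed.

Section Eval2.
Variables (G : groupType) (X Y : G).

Lemma eval2M : {morph eval2 X Y : v w / (v * w)%g}.
Proof. exact: fevalM. Qed.

Lemma eval2_1 : eval2 X Y 1%g = 1%g.
Proof. by apply: (mulgI (eval2 X Y 1%g)); rewrite -eval2M !mulg1. Qed.

Lemma eval2_expgz w a : eval2 X Y (expgz w a) = expgz (eval2 X Y w) a.
Proof.
have pos n : eval2 X Y (w ^+ n)%g = (eval2 X Y w ^+ n)%g.
  by elim: n => [|n IHn]; rewrite ?eval2_1 // !expgS eval2M IHn.
case: a => n; rewrite /= ?pos //.
by apply: (mulgI (eval2 X Y w ^+ n.+1)%g); rewrite -{1}pos -eval2M !mulgV eval2_1.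
Qed.

Lemma eval2_syllables r (a b : 'I_r -> int) :
  eval2 X Y (\prod_(i < r) (expgz F2x (a i) * expgz F2y (b i)))%g =
    (\prod_(i < r) (expgz X (a i) * expgz Y (b i)))%g.
Proof.
rewrite (big_morph _ eval2M eval2_1); apply: eq_bigr => i _.
by rewrite eval2M !eval2_expgz /eval2 !feval_gen.
Qed.

End Eval2.

(** * The leading coefficient of the trace of a word *)

Lemma SL2valM (R : comNzRingType) (X Y : SL2 R) :
  val (X * Y)%g = (val X : 'M_2) * val Y.
Proof. by []. Qed.

Lemma SL2val_prod (R : comNzRingType) (r : nat) (g : 'I_r -> SL2 R) :
  SL2val (\prod_(i < r) g i)%g = \prod_(i < r) SL2val (g i).
Proof. exact: (big_morph (@SL2val R) (@SL2valM R) (erefl _)). Qed.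

Lemma mulmxE_entry (R : pzRingType) (n : nat) (A B : 'M[R]_n.+1) i j :
  (A * B) i j = \sum_k A i k * B k j.
Proof. by rewrite mxE. Qed.

Lemma mulmx2_entry (R : pzRingType) (A B : 'M[R]_2) i j :
  (A * B) i j = A i 0 * B 0 j + A i 1 * B 1 j.
Proof.
rewrite mulmxE_entry big_ord_recl big_ord1.
by have -> : lift ord0 ord0 = 1 :> 'I_2 by apply: val_inj.
Qed.

Lemma coef_prod_linear_mx (R : comNzRingType) (n r : nat) (C P : 'I_r -> 'M[R]_n.+1)
    (M := \prod_(i < r) (map_mx polyC (C i) + 'X *: map_mx polyC (P i))) j k :
  (size (M j k) <= r.+1)%N /\ (M j k)`_r = (\prod_(i < r) P i) j k.
Proof.
rewrite {}/M; elim: r C P j => [|r IHr] C P j.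
  rewrite !big_ord0 !mxE -polyCMn size_polyC coefC.
  by split; [apply: leq_b1 | ].
rewrite !big_ord_recl !mulmxE_entry.
set M := \prod_(i < r) _.
split.
  apply: (leq_trans (size_sum _ _ _)); apply/bigmax_leqP => l _.
  rewrite !mxE; apply: leq_trans (size_polyMleq _ _) _.
  have [sz _] := IHr (fun i => C (lift ord0 i)) (fun i => P (lift ord0 i)) l.
  have sz1 : (size ((C ord0 j l)%:P + 'X * (P ord0 j l)%:P)%R <= 2)%N.
    rewrite (leq_trans (size_polyD _ _)) // geq_max.
    rewrite (leq_trans (size_polyC_leq1 _)) // mulrC mul_polyC.
    by rewrite (leq_trans (size_scale_leq _ _)) // size_polyX.
  by rewrite -subn1 leq_subLR (leq_add sz1 sz).
rewrite coef_sum; apply: eq_bigr => l _; rewrite !mxE.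
have [sz <-] := IHr (fun i => C (lift ord0 i)) (fun i => P (lift ord0 i)) l.
rewrite -/M mulrDl coefD coefCM -mulrA coefXM /= coefCM nth_default ?mulr0 ?add0r //.
Qed.

Lemma tr_prod_triangular (R : comNzRingType) (r : nat) (P : 'I_r -> 'M[R]_2) :
    (forall i, P i 0 1 = 0) \/ (forall i, P i 1 0 = 0) ->
  \tr (\prod_(i < r) P i) = \prod_(i < r) P i 0 0 + \prod_(i < r) P i 1 1.
Proof.
rewrite /mxtrace big_ord_recl big_ord1.
have -> : lift ord0 ord0 = 1 :> 'I_2 by apply: val_inj.
move=> tri.
suff : \prod_(i < r) P i 0 0 = (\prod_(i < r) P i) 0 0 /\
         \prod_(i < r) P i 1 1 = (\prod_(i < r) P i) 1 1 by case=> -> ->.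
case: tri => tri.
  suff : [/\ \prod_(i < r) P i 0 0 = (\prod_(i < r) P i) 0 0,
         \prod_(i < r) P i 1 1 = (\prod_(i < r) P i) 1 1
         & (\prod_(i < r) P i) 0 1 = 0] by case.
  elim: r P tri => [|r IHr] P tri; first by rewrite !big_ord0 !mxE.
  have [| IH0 IH1 IH01] := IHr (fun i => P (lift ord0 i)); first by move=> i.
  by rewrite !big_ord_recl !mulmx2_entry tri IH0 IH1 IH01; split; ring.
suff : [/\ \prod_(i < r) P i 0 0 = (\prod_(i < r) P i) 0 0,
       \prod_(i < r) P i 1 1 = (\prod_(i < r) P i) 1 1
       & (\prod_(i < r) P i) 1 0 = 0] by case.
elim: r P tri => [|r IHr] P tri; first by rewrite !big_ord0 !mxE.
have [| IH0 IH1 IH10] := IHr (fun i => P (lift ord0 i)); first by move=> i.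
by rewrite !big_ord_recl !mulmx2_entry tri IH0 IH1 IH10; split; ring.
Qed.

(** A matrix affine in ['X] whose slope is traceless has constant trace, so its
    powers are again affine in ['X]. *)
Lemma expgz_affine (R : comNzRingType) (X : SL2 {poly R}) (X0 X1 : 'M[R]_2) a :
    val X = map_mx polyC X0 + 'X *: map_mx polyC X1 -> \tr X1 = 0 ->
  val (expgz X a) =
    map_mx polyC (chebUz a (\tr X0) *: X0 - (chebUz (a - 1) (\tr X0))%:M)
    + 'X *: map_mx polyC (chebUz a (\tr X0) *: X1).
Proof.
move=> XE X1_tr0; have -> := expgz_mx _ X a.
have -> : \tr X = (\tr X0)%:P.
  by rewrite XE mxtraceD mxtraceZ !trace_map_mx X1_tr0 rmorph0 mulr0 addr0.
rewrite -!(rmorph_chebUz _ _ polyC) XE.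
apply/matrixP => i j; rewrite !mxE.
rewrite !(polyCD, polyCN, polyCM) polyCMn; case: (i == j) => /=; ring.
Qed.

Lemma mul_affine_mx (R : comNzRingType) (n : nat) (A A' B B' : 'M[R]_n) :
    A' *m B' = 0 ->
  (map_mx polyC A + 'X *: map_mx polyC A') *m (map_mx polyC B + 'X *: map_mx polyC B')
    = map_mx polyC (A *m B) + 'X *: map_mx polyC (A *m B' + A' *m B).
Proof.
move=> AB'; rewrite mulmxDl !mulmxDr -!scalemxAl -!scalemxAr -!map_mxM AB'.
by rewrite map_mx0 !scaler0 addr0 -addrA map_mxD scalerDr.
Qed.

(** Each syllable [X^a Y^b] is affine in ['X] since [X1 * Y1 = 0]; the slopes
    [Q i] multiply to the coefficient of ['X^r]. *)
Lemma coef_trace_word (R : comNzRingType) (X Y : SL2 {poly R})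
    (X0 X1 Y0 Y1 : 'M[R]_2) (r : nat) (a b : 'I_r -> int)
    (Q := fun i =>
      (chebUz (a i) (\tr X0) *: X0 - (chebUz (a i - 1) (\tr X0))%:M) *
        (chebUz (b i) (\tr Y0) *: Y1) +
      (chebUz (a i) (\tr X0) *: X1) *
        (chebUz (b i) (\tr Y0) *: Y0 - (chebUz (b i - 1) (\tr Y0))%:M))
    (T := \tr (\prod_(i < r) (expgz X (a i) * expgz Y (b i)))%g) :
    val X = map_mx polyC X0 + 'X *: map_mx polyC X1 -> \tr X1 = 0 ->
    val Y = map_mx polyC Y0 + 'X *: map_mx polyC Y1 -> \tr Y1 = 0 ->
    X1 * Y1 = 0 ->
  (size T <= r.+1)%N /\ T`_r = \tr (\prod_(i < r) Q i).
Proof.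
move=> XE X1_tr YE Y1_tr XY1.
pose C i := (chebUz (a i) (\tr X0) *: X0 - (chebUz (a i - 1) (\tr X0))%:M) *
  (chebUz (b i) (\tr Y0) *: Y0 - (chebUz (b i - 1) (\tr Y0))%:M).
have -> : T = \tr (\prod_(i < r) (map_mx polyC (C i) + 'X *: map_mx polyC (Q i))).
  rewrite /T; congr (\tr _).
  rewrite SL2val_prod; apply: eq_bigr => i _.
  rewrite [SL2val _]SL2valM (expgz_affine _ _ _ _ _ XE X1_tr).
  rewrite (expgz_affine _ _ _ _ _ YE Y1_tr) /C /Q.
  apply: mul_affine_mx.
  by rewrite -scalemxAl -scalemxAr [_ *m _]XY1 !scaler0.
rewrite /mxtrace coef_sum; split.
  apply: (leq_trans (size_sum _ _ _)); apply/bigmax_leqP => l _.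
  by case: (coef_prod_linear_mx R _ r C Q l l).
by apply: eq_bigr => l _; case: (coef_prod_linear_mx R _ r C Q l l).
Qed.

Section LeadTrace.
Variables (R : comNzRingType) (r : nat) (a b : 'I_r -> int) (X Y : SL2 {poly R}).
Variables (X0 Y0 : 'M[R]_2).
Hypothesis r_gt0 : (0 < r)%N.
Let T := \tr (\prod_(i < r) (expgz X (a i) * expgz Y (b i)))%g.

Let prod0 : \prod_(i < r) (0 : R) = 0.
Proof. by rewrite prodr_const card_ord expr0n eqn0Ngt r_gt0. Qed.

(** Here [X] is constant and [u] is the lower left entry of [Y].  The slope of a
    syllable has only its first column nonzero, so the trace of the product of
    the slopes is the product of their upper left entries. *)
Lemma lead_trace_lower :
    val X = map_mx polyC X0 ->
    val Y = map_mx polyC Y0 + 'X *: map_mx polyC (delta_mx 1 0) ->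
  (size T <= r.+1)%N /\
  T`_r = \prod_(i < r) (X0 0 1 * chebUz (a i) (\tr X0) * chebUz (b i) (\tr Y0)).
Proof.
move=> XE YE.
have {}XE : val X = map_mx polyC X0 + 'X *: map_mx polyC 0.
  by rewrite XE map_mx0 scaler0 addr0.
have tr_delta : \tr (delta_mx 1 0 : 'M[R]_2) = 0.
  by rewrite /mxtrace big_ord_recl big_ord1 !mxE /= addr0.
have [sz ->] := coef_trace_word _ _ _ _ _ _ _ _ a b XE (raddf0 _) YE tr_delta (mul0r _).
split=> //; rewrite tr_prod_triangular; last first.
  by left=> i; rewrite scaler0 mul0r addr0 mulmx2_entry !mxE /= !mulr0 addr0.
rewrite [X in _ + X](eq_bigr (fun=> 0)) ?prod0 ?addr0 => [|i _]; last first.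
  by rewrite scaler0 mul0r addr0 mulmx2_entry !mxE /= !mulr0 addr0.
apply: eq_bigr => i _; rewrite scaler0 mul0r addr0 mulmx2_entry !mxE /=; ring.
Qed.

(** The mirror image, with [u] the upper right entry of [X]: now the slopes have
    only their first row nonzero.  It leaves the trace of [Y] free when [X] is
    unipotent. *)
Lemma lead_trace_upper :
    val X = map_mx polyC X0 + 'X *: map_mx polyC (delta_mx 0 1) ->
    val Y = map_mx polyC Y0 ->
  (size T <= r.+1)%N /\
  T`_r = \prod_(i < r) (Y0 1 0 * chebUz (a i) (\tr X0) * chebUz (b i) (\tr Y0)).
Proof.
move=> XE YE.
have {}YE : val Y = map_mx polyC Y0 + 'X *: map_mx polyC 0.
  by rewrite YE map_mx0 scaler0 addr0.
have tr_delta : \tr (delta_mx 0 1 : 'M[R]_2) = 0.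
  by rewrite /mxtrace big_ord_recl big_ord1 !mxE /= addr0.
have [sz ->] := coef_trace_word _ _ _ _ _ _ _ _ a b XE tr_delta YE (raddf0 _) (mulr0 _).
split=> //; rewrite tr_prod_triangular; last first.
  by right=> i; rewrite scaler0 mulr0 add0r mulmx2_entry !mxE /= !(mulr0, mul0r) addr0.
rewrite [X in _ + X](eq_bigr (fun=> 0)) ?prod0 ?addr0 => [|i _]; last first.
  by rewrite scaler0 mulr0 add0r mulmx2_entry !mxE /= !(mulr0, mul0r) addr0.
apply: eq_bigr => i _; rewrite scaler0 mulr0 add0r mulmx2_entry !mxE /=; ring.
Qed.

End LeadTrace.

(** * Equality of the absolute values of the exponents *)

Lemma mup_prod (F : fieldType) (I : finType) (x : F) (p : I -> {poly F}) :
    (forall i, p i != 0) ->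
  mup x (\prod_i p i) = (\sum_i mup x (p i))%N.
Proof.
move=> p_neq0.
suff [] : \prod_i p i != 0 /\ mup x (\prod_i p i) = (\sum_i mup x (p i))%N by [].
elim/big_rec2: _ => [|i m P _ [P_neq0 <-]].
  by rewrite oner_eq0 mupNroot // root1.
by rewrite mulf_neq0 // mupM.
Qed.

Lemma chebUzX_neq0 (F : numFieldType) (a : int) : a != 0 -> chebUz a ('X : {poly F}) != 0.
Proof.
apply: contraNneq => Ua0; rewrite -(intr_eq0 F) -chebUz_at2 -[X in chebUz _ X](hornerX 2).
by rewrite -(rmorph_chebUz _ _ (horner_eval 2)) Ua0 rmorph0.
Qed.

(** At [z + 1/z] the polynomial [U_a] is [z^a - z^-a] up to a nonzero factor, so
    it vanishes exactly when [2n] divides [2a]. *)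
Lemma mup_chebUz (F : numFieldType) (n : nat) (z : F) (a : int) :
    (1 < n)%N -> (2 * n).-primitive_root z -> (0 < `|a| <= n)%N ->
  mup (z + z^-1) (chebUz a 'X) = (`|a|%N == n).
Proof.
move=> n_gt1 z_prim /andP[a_gt0 a_le_n].
have -> : mup (z + z^-1) (chebUz a 'X) = mup (z + z^-1) (chebU `|a|%N 'X).
  rewrite chebUz_abs mupMr // /root -signr_odd.
  by case: odd; rewrite ?expr0 ?expr1 ?hornerN hornerC ?oppr_eq0 oner_eq0.
have z_neq0 : z != 0.
  apply/eqP => z0; have := prim_expr_order z_prim; rewrite z0 expr0n muln_eq0 /=.
  by rewrite gtn_eqF ?(ltnW n_gt1) // => /eqP; rewrite eq_sym oner_eq0.
have zV k : (z ^+ k == z ^- k) = (2 * n %| 2 * k)%N.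
  rewrite (prim_order_dvd z_prim) mul2n -addnn exprD -(inj_eq (mulIf (expf_neq0 k z_neq0))).
  by rewrite mulVf ?expf_neq0.
have z_neqV : z - z^-1 != 0.
  by rewrite subr_eq0 -[z]expr1 zV muln1 gtnNdvd //; lia.
have rU : root (chebU `|a|%N 'X) (z + z^-1) = (`|a|%N == n).
  rewrite /root horner_chebUX -(inj_eq (mulIf z_neqV)) mul0r.
  have := chebUz_sumV F `|a|%N z z_neq0; rewrite /chebUz /= -exprnN => ->.
  rewrite subr_eq0 zV dvdn_pmul2l //; apply/idP/eqP => [/dvdn_leq|->//].
  by move/(_ a_gt0) => le_n; apply/eqP; rewrite eqn_leq a_le_n.
by case: eqVneq rU => _ rU; [apply: chebU_simple_root | apply: mupNroot; rewrite rU].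
Qed.

(** Let [n] be the largest [|a i|] and [z] a primitive [2n]-th root of unity.  The
    multiplicity of [z + 1/z] as a root of the product is the number of [i] with
    [|a i| = n], and being a multiple of [r] it can only be [r]. *)
Lemma abs_eq_of_power (r : nat) (a : 'I_r -> int) (p : {poly algC}) (c : algC) :
    (forall i, a i != 0) -> c != 0 ->
    p ^+ r = c%:P * \prod_(i < r) chebUz (a i) 'X ->
  forall i j, `|a i|%N = `|a j|%N.
Proof.
move=> a_neq0 c_neq0 pE i0.
have aP i : (0 < `|a i|)%N by rewrite absz_gt0.
pose m := [arg max_(i > i0) `|a i|%N]; pose n := `|a m|%N.
have a_le i : (`|a i| <= n)%N by rewrite /n /m; case: arg_maxnP => // k _; apply.
suff an : forall i, `|a i|%N = n by move=> j; rewrite !an.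
(* For n = 1 the point z + 1/z = -2 is no root: there z = 1/z. *)
have [n_le1|n_gt1] := leqP n 1.
  by move=> i; apply/eqP; rewrite eqn_leq a_le (leq_trans n_le1).
have [|z z_prim] := @C_prim_root_exists (2 * n); first by rewrite muln_gt0 (ltnW n_gt1).
have P_neq0 : \prod_(i < r) chebUz (a i) ('X : {poly algC}) != 0.
  by apply/prodf_neq0 => k _; apply: chebUzX_neq0.
have p_neq0 : p != 0.
  apply: contraNneq P_neq0 => p0; move/eqP: pE; rewrite p0 expr0n.
  by rewrite eqn0Ngt (leq_ltn_trans _ (ltn_ord i0)) // eq_sym mulf_eq0 polyC_eq0 (negPf c_neq0).
pose N := #|[pred k | `|a k|%N == n]|.
have mupE : (r * mup (z + z^-1) p = N)%N.
  have <- : mup (z + z^-1) (p ^+ r) = (r * mup (z + z^-1) p)%N.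
    have -> : p ^+ r = \prod_(i < r) p by rewrite prodr_const card_ord.
    by rewrite mup_prod // sum_nat_const card_ord.
  rewrite pE mupMr ?rootC // mup_prod => [|k]; last exact: chebUzX_neq0.
  rewrite /N -sum1_card [in RHS]big_mkcond /=; apply: eq_bigr => k _.
  by rewrite (mup_chebUz _ n) ?aP ?a_le // inE; case: eqP.
have N_gt0 : (0 < N)%N by apply/card_gt0P; exists m; rewrite inE.
have N_le : (r <= N)%N.
  rewrite -mupE leq_pmulr //; move: N_gt0; rewrite -mupE.
  by case: mup; rewrite ?muln0.
have /subset_cardP/(_ (subset_predT _)) NT : N = #|'I_r|.
  by apply/eqP; rewrite eqn_leq max_card card_ord.
by move=> i; apply/eqP; have := NT i; rewrite !inE.
Qed.

(** * Equality in the triangle inequality *)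

(** With [e] the sign of the sum, [|\sum c i|] is the sum of the [e c i], each at
    most [|c i|]; so none of these inequalities can be strict. *)
Lemma abs_sum_extremal (R : realDomainType) (I : finType) (c : I -> R) :
    \sum_i `|c i| <= `|\sum_i c i| ->
  forall i, `|c i| = Num.sg (\sum_i c i) * c i.
Proof.
move=> le_sum i; set S := \sum_i c i in le_sum *.
have term_ge0 k : true -> 0 <= `|c k| - Num.sg S * c k.
  move=> _; rewrite subr_ge0 (le_trans (ler_norm _)) // normrM ler_piMl //.
  by rewrite normr_sg lern1 leq_b1.
have sum0 : \sum_k (`|c k| - Num.sg S * c k) = 0.
  apply/le_anti; rewrite sumr_ge0 // andbT sumrB -mulr_sumr -/S.
  by rewrite -normrEsg subr_le0.
by apply/subr0_eq/(psumr_eq0P term_ge0 sum0).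
Qed.

Lemma abs_sum_extremal_const (R : realDomainType) (I : finType) (c : I -> R) :
    (forall i, c i != 0) -> (forall i j, `|c i| = `|c j|) ->
    \sum_i `|c i| <= `|\sum_i c i| ->
  forall i j, c i = c j.
Proof.
move=> c_neq0 c_abs /abs_sum_extremal c_sg i j.
have sg_neq0 : Num.sg (\sum_i c i) != 0.
  by apply: contraNneq (c_neq0 i) => sg0; rewrite -normr_eq0 c_sg sg0 mul0r.
by apply: (mulfI sg_neq0); rewrite -!c_sg.
Qed.

(** * Explicit two by two matrices *)

Definition mx2 (R : Type) (a b c d : R) : 'M[R]_2 :=
  \matrix_(i, j) if i == 0 then (if j == 0 then a else b) else if j == 0 then c else d.
Arguments mx2 {R} a b c d.

Section Mx2.
Variable R : comNzRingType.
Implicit Types a b c d : R.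

Lemma tr_mx2 a b c d : \tr (mx2 a b c d) = a + d.
Proof. by rewrite /mxtrace big_ord_recl big_ord1 !mxE. Qed.

Lemma mul_mx2 a b c d a' b' c' d' :
  mx2 a b c d *m mx2 a' b' c' d' =
    mx2 (a * a' + b * c') (a * b' + b * d') (c * a' + d * c') (c * b' + d * d').
Proof.
apply/matrixP => i j; rewrite !mxE big_ord_recl big_ord1 !mxE /=.
by case: (i == 0); case: (j == 0).
Qed.

Lemma adj_mx2 a b c d : \adj (mx2 a b c d) = mx2 d (- b) (- c) a.
Proof.
rewrite adj2 tr_mx2; apply/matrixP => i j; rewrite !mxE.
by case: i j => [[|[|//]] ?] [[|[|//]] ?]; rewrite -!val_eqE /=; ring.
Qed.

Lemma det_mx2 a b c d : \det (mx2 a b c d) = a * d - b * c.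
Proof.
have := congr1 (fun M : 'M_2 => M 0 0) (mul_mx_adj (mx2 a b c d)).
by rewrite adj_mx2 mul_mx2 !mxE /= mulr1n mulrN => ->.
Qed.

Lemma one_mx2 : 1%:M = mx2 1 0 0 1 :> 'M[R]_2.
Proof. by apply/matrixP => -[[|[|//]] ?] [[|[|//]] ?]; rewrite !mxE. Qed.

Lemma map_mx2 (S : Type) (g : R -> S) a b c d :
  map_mx g (mx2 a b c d) = mx2 (g a) (g b) (g c) (g d).
Proof. by apply/matrixP => i j; rewrite !mxE; case: eqP; case: eqP. Qed.

Lemma affine_mx2_lower a b :
  map_mx polyC (mx2 a 0 0 b) + 'X *: map_mx polyC (delta_mx 1 0) =
    mx2 a%:P 0 'X b%:P.
Proof.
by apply/matrixP => -[[|[|//]] ?] [[|[|//]] ?]; rewrite !mxE /= ?(mulr0, mulr1, addr0, add0r).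
Qed.

Lemma affine_mx2_upper a b :
  map_mx polyC (mx2 a 0 0 b) + 'X *: map_mx polyC (delta_mx 0 1) =
    mx2 a%:P 'X 0 b%:P.
Proof.
by apply/matrixP => -[[|[|//]] ?] [[|[|//]] ?]; rewrite !mxE /= ?(mulr0, mulr1, addr0, add0r).
Qed.

End Mx2.

(** The matrix [M] is kept beside its entries because the same matrix is needed
    in the affine form [map_mx polyC _ + 'X *: map_mx polyC _]. *)
Lemma SL2_of_mx2 (R : comNzRingType) (M : 'M[R]_2) (a b c d : R) :
  M = mx2 a b c d -> a * d - b * c = 1 -> {X : SL2 R | val X = M}.
Proof.
move=> ME abcd; have M_det : \det M == 1 by rewrite ME det_mx2 abcd.
by exists (SL2Mx M_det).
Qed.

Section Diagonal.
Variables (F : fieldType) (X : SL2 F) (z : F).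
Hypothesis (XE : val X = mx2 z 0 0 z^-1).

Lemma expgz_diag (a : int) : val (expgz X a) = mx2 (z ^ a) 0 0 (z ^ (- a)).
Proof.
have pos n : val (X ^+ n)%g = mx2 (z ^+ n) 0 0 (z ^- n).
  elim: n => [|n IHn]; first by rewrite expr0 invr1; apply: one_mx2.
  rewrite expgS; transitivity (val X *m val (X ^+ n)%g); first by [].
  rewrite IHn XE mul_mx2.
  by rewrite !(mulr0, mul0r, addr0, add0r) exprS invfM.
case: a => n; first by rewrite /expgz pos exprnN.
rewrite [LHS](_ : _ = \adj (val (X ^+ n.+1)%g)) // pos adj_mx2 !oppr0.
by rewrite exprnN NegzE opprK.
Qed.

End Diagonal.

Lemma prodr_exprz (F : fieldType) (I : finType) (z : F) (a : I -> int) :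
  z != 0 -> \prod_i z ^ a i = z ^ (\sum_i a i).
Proof.
by move=> z0; rewrite (big_morph (fun k => z ^ k) (fun m n => expfzDr m n z0) (expr0z z)).
Qed.

Lemma trace_diag (F : fieldType) (r : nat) (a b : 'I_r -> int) (X Y : SL2 F) (x y : F) :
    x != 0 -> y != 0 -> val X = mx2 x 0 0 x^-1 -> val Y = mx2 y 0 0 y^-1 ->
  \tr (\prod_(i < r) (expgz X (a i) * expgz Y (b i)))%g =
    x ^ (\sum_i a i) * y ^ (\sum_i b i) + x ^ (- \sum_i a i) * y ^ (- \sum_i b i).
Proof.
move=> x0 y0 XE YE; rewrite SL2val_prod.
rewrite (eq_bigr (fun i => mx2 (x ^ a i * y ^ b i) 0 0 (x ^ (- a i) * y ^ (- b i)))).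
  rewrite tr_prod_triangular; last by left=> i; rewrite mxE.
  rewrite -!sumrN -!prodr_exprz // -!big_split.
  by congr (_ + _); apply: eq_bigr => i _; rewrite mxE.
move=> i _; transitivity (val (expgz X (a i)) *m val (expgz Y (b i))); first by [].
rewrite (expgz_diag _ _ _ XE) (expgz_diag _ _ _ YE) mul_mx2.
by rewrite !(mulr0, mul0r, addr0, add0r).
Qed.

(** * Growth estimates *)

Section Growth.
Variable R : realFieldType.
Implicit Types d x z : R.

(** Since [|x| >= d/2] gives [(d/4)^r <= |D_r(x)| <= 2 z^k], the bound on [z^N]
    becomes [z^N <= 2 * 16^r z^k < z^(k+1)]. *)
Lemma dickson_growth (r N k : nat) (z d x : R) :
    2 * 16 ^+ r < z -> 1 <= z -> 4 <= d -> d / 2 <= `|x| ->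
    z ^+ N <= 4 ^+ r * d ^+ r -> `|(dickson R r).[x]| <= 2 * z ^+ k ->
  (N <= k)%N.
Proof.
move=> z_gt z_ge1 d_ge4 x_ge zN_le Dx_le.
have x_ge2 : 2 <= `|x| by lra.
have d4_le : (d / 4) ^+ r <= 2 * z ^+ k.
  apply: le_trans (le_trans (dickson_lower_bound _ r x x_ge2) Dx_le).
  by apply: lerXn2r; rewrite ?nnegrE; lra.
have {}zN_le : z ^+ N < z ^+ k.+1.
  apply: (le_lt_trans zN_le); rewrite -exprMn.
  have -> : 4 * d = 16 * (d / 4) by field.
  have zk_gt0 : 0 < z ^+ k by rewrite exprn_gt0 //; lra.
  rewrite exprMn exprS; apply: (@le_lt_trans _ _ (16 ^+ r * (2 * z ^+ k))).
    by rewrite ler_wpM2l // exprn_ge0.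
  by rewrite mulrA [_ * 2]mulrC ltr_pM2r.
by rewrite -ltnS ltnNge; apply: contraTN zN_le => le_kN; rewrite -leNgt ler_weXn2l.
Qed.

Lemma abs_exprz_subV_ge z (a : int) : 2 <= z -> a != 0 ->
  z ^+ `|a|%N / 2 <= `|z ^ a - z ^ (- a)|.
Proof.
move=> z_ge2.
have pos n : (0 < n)%N -> z ^+ n / 2 <= z ^+ n - z ^- n.
  move=> n_gt0; have zn_ge2 : 2 <= z ^+ n.
    apply: (le_trans z_ge2); rewrite -{1}[z]expr1.
    by apply: ler_weXn2l => //; lra.
  have : z ^- n <= 2^-1 by rewrite lef_pV2 ?posrE; lra.
  by lra.
case: a => n a_neq0.
  by apply: le_trans (ler_norm _); rewrite -exprnN /= pos // lt0n.
rewrite distrC; apply: le_trans (ler_norm _).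
by rewrite NegzE opprK abszN absz_nat -exprnN pos.
Qed.

Lemma abs_exprz_addV_le z (a : int) : 1 <= z ->
  `|z ^ a + z ^ (- a)| <= 2 * z ^+ `|a|%N.
Proof.
move=> z_ge1.
have pos n : `|z ^+ n + z ^- n| <= 2 * z ^+ n.
  have zn_ge1 : 1 <= z ^+ n by rewrite exprn_ege1.
  have : z ^- n <= 1 by rewrite invf_le1 //; lra.
  have : 0 <= z ^- n by rewrite invr_ge0; lra.
  by move=> ? ?; rewrite ger0_norm; lra.
case: a => n; first by rewrite -exprnN pos.
by rewrite NegzE opprK abszN absz_nat -exprnN addrC pos.
Qed.

End Growth.

(** * Evaluation of multivariate polynomials *)

Lemma rmorph_mmap (n : nat) (R : nzRingType) (S T : comNzRingType)
    (phi : {rmorphism S -> T}) (psi : R -> S) (h : 'I_n -> S)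
    (p : {mpoly R[n]}) :
  phi (mmap psi h p) = mmap (phi \o psi) (phi \o h) p.
Proof.
rewrite /mmap rmorph_sum; apply: eq_bigr => m _; rewrite rmorphM rmorph_prod.
by congr (_ * _); apply: eq_bigr => i _; rewrite rmorphXn.
Qed.

Lemma eq_mmap (n : nat) (R S : nzRingType) (psi psi' : R -> S) (h h' : 'I_n -> S)
    (p : {mpoly R[n]}) :
  psi =1 psi' -> h =1 h' -> mmap psi h p = mmap psi' h' p.
Proof.
move=> eq_psi eq_h; rewrite /mmap; apply: eq_bigr => m _; rewrite eq_psi.
by congr (_ * _); apply: eq_bigr => i _; rewrite eq_h.
Qed.

Lemma mmap_map_mpoly (n : nat) (R : nzRingType) (S T : comNzRingType)
    (phi : R -> S) (psi : {rmorphism S -> T}) (h : 'I_n -> T)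
    (p : {mpoly R[n]}) :
  mmap psi h (map_mpoly phi p) = mmap (psi \o phi) h p.
Proof.
rewrite /map_mpoly (rmorph_mmap _ _ _ _ (mmap psi h)).
apply: eq_mmap => x /=; first by rewrite mmapC.
by rewrite mmapX mmap1U.
Qed.

(** * The trace polynomial of the word as a Dickson polynomial *)

Section Word.
Variables (r : nat) (r_gt0 : (0 < r)%N) (a b : 'I_r -> int).
Hypotheses (a_neq0 : forall i, a i != 0) (b_neq0 : forall i, b i != 0).
Variables (f : {mpoly int[3]}) (q : {mpoly rat[3]}).
Hypothesis f_trace :
  is_trace_poly (\prod_(i < r) (expgz F2x (a i) * expgz F2y (b i)))%g f.
Hypothesis f_dickson : map_mpoly intr f = (dickson {mpoly rat[3]} r).[q].

Lemma trace_word (S : comNzRingType) (X Y : SL2 S) :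
  \tr (\prod_(i < r) (expgz X (a i) * expgz Y (b i)))%g =
    mmap intr (tnth [tuple \tr X; \tr (X * Y)%g; \tr Y]) f.
Proof. by rewrite -f_trace eval2_syllables. Qed.

Lemma trace_dickson (S : comNzRingType) (iota : {rmorphism rat -> S}) (X Y : SL2 S) :
  \tr (\prod_(i < r) (expgz X (a i) * expgz Y (b i)))%g =
    (dickson S r).[mmap iota (tnth [tuple \tr X; \tr (X * Y)%g; \tr Y]) q].
Proof.
rewrite trace_word; set h := tnth _.
rewrite -(rmorph_dickson _ _ (mmap iota h)) -f_dickson /= mmap_map_mpoly.
by apply: eq_mmap => // x /=; rewrite rmorph_int.
Qed.

(** Specialising [q] at the traces of [X] and [Y] gives a polynomial in one
    variable whose image under [D_r] has degree [r]; it is therefore linear. *)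
Lemma trace_linear_root (R : idomainType) (iota : {rmorphism rat -> R})
    (X Y : SL2 {poly R}) (T := \tr (\prod_(i < r) (expgz X (a i) * expgz Y (b i)))%g) :
    (size T <= r.+1)%N -> T`_r != 0 ->
  exists A B : R, A ^+ r = T`_r /\ T = (dickson {poly R} r).[A *: 'X + B%:P].
Proof.
move=> szT Tr_neq0; have := trace_dickson _ (polyC \o iota) X Y.
rewrite -/T; set Q := mmap _ _ q => TE.
have {}szT : size T = r.+1.
  by apply/eqP; rewrite eqn_leq szT; apply: contraNT Tr_neq0; rewrite -leqNgt => /leq_sizeP ->.
have [] := dickson_linear _ r Q r_gt0; rewrite -TE // => szQ; rewrite lead_coefE szT /= => lcT.
exists Q`_1, Q`_0; split=> //; rewrite TE; congr (_.[_]).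
apply/polyP => -[|[|i]]; rewrite coefD coefZ coefX coefC /= ?(mulr0, mulr1, add0r, addr0) //.
by rewrite nth_default // (leq_trans szQ).
Qed.

Let prod_intr_neq0 (c : 'I_r -> int) : (forall i, c i != 0) ->
  \prod_(i < r) ((c i)%:~R : algC) != 0.
Proof. by move=> c_neq0; apply/prodf_neq0 => i _; rewrite intr_eq0. Qed.

(** [X] is a companion matrix, so its trace is the free variable ['X] of
    [{poly algC}], and [Y] is unipotent, so that [U_b(tr Y) = b]. *)
Lemma abs_a_eq i j : `|a i|%N = `|a j|%N.
Proof.
have [X XE] : {X : SL2 {poly {poly algC}} | val X = map_mx polyC (mx2 'X 1 (-1) 0)}.
  by apply: SL2_of_mx2; [apply: map_mx2 | rewrite polyCN; ring].
have [Y YE] : {Y : SL2 {poly {poly algC}} |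
    val Y = map_mx polyC (mx2 1 0 0 1) + 'X *: map_mx polyC (delta_mx 1 0)}.
  by apply: SL2_of_mx2; [apply: affine_mx2_lower | ring].
have [szT TE] := lead_trace_lower _ _ a b _ _ _ _ r_gt0 XE YE.
have {}TE : (\tr (\prod_(i < r) (expgz X (a i) * expgz Y (b i)))%g)`_r =
    (\prod_(i < r) (b i)%:~R)%:P * \prod_(i < r) chebUz (a i) 'X.
  rewrite TE rmorph_prod -big_split; apply: eq_bigr => k _.
  by rewrite !tr_mx2 addr0 chebUz_at2 rmorph_int mxE /= mul1r mulrC.
have [|A [B [AE _]]] := trace_linear_root _ (polyC \o ratr) X Y szT.
  rewrite TE mulf_neq0 ?polyC_eq0 ?prod_intr_neq0 //.
  by apply/prodf_neq0 => k _; apply: chebUzX_neq0.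
by apply: (abs_eq_of_power r a A) a_neq0 (prod_intr_neq0 _ b_neq0) _ i j; rewrite AE.
Qed.

(** As for [abs_a_eq], with the unipotent and the companion matrix exchanged. *)
Lemma abs_b_eq i j : `|b i|%N = `|b j|%N.
Proof.
have [Y YE] : {Y : SL2 {poly {poly algC}} | val Y = map_mx polyC (mx2 'X (-1) 1 0)}.
  by apply: SL2_of_mx2; [apply: map_mx2 | rewrite polyCN; ring].
have [X XE] : {X : SL2 {poly {poly algC}} |
    val X = map_mx polyC (mx2 1 0 0 1) + 'X *: map_mx polyC (delta_mx 0 1)}.
  by apply: SL2_of_mx2; [apply: affine_mx2_upper | ring].
have [szT TE] := lead_trace_upper _ _ a b _ _ _ _ r_gt0 XE YE.
have {}TE : (\tr (\prod_(i < r) (expgz X (a i) * expgz Y (b i)))%g)`_r =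
    (\prod_(i < r) (a i)%:~R)%:P * \prod_(i < r) chebUz (b i) 'X.
  rewrite TE rmorph_prod -big_split; apply: eq_bigr => k _.
  by rewrite !tr_mx2 addr0 chebUz_at2 rmorph_int mxE /= mul1r.
have [|A [B [AE _]]] := trace_linear_root _ (polyC \o ratr) X Y szT.
  rewrite TE mulf_neq0 ?polyC_eq0 ?prod_intr_neq0 //.
  by apply/prodf_neq0 => k _; apply: chebUzX_neq0.
by apply: (abs_eq_of_power r b A) b_neq0 (prod_intr_neq0 _ a_neq0) _ i j; rewrite AE.
Qed.

(** [X] and [Y] have trace [z + 1/z] for a single large rational [z], and the
    trace of [XY] is [u] up to a constant; no passage to the limit is needed,
    [z > 2 * 16^r] being large enough to compare exponents.  The two commuting
    pairs correspond to ['X = 0] and ['X = - (z - 1/z)^2]. *)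
Lemma sum_abs_le :
  (\sum_(i < r) (`|a i| + `|b i|) <= `|(\sum_i a i + \sum_i b i)%R|)%N \/
  (\sum_(i < r) (`|a i| + `|b i|) <= `|(\sum_i a i - \sum_i b i)%R|)%N.
Proof.
set E := \sum_i a i; set D := \sum_i b i.
set N := (\sum_(i < r) _)%N.
pose z : rat := 2 * 16 ^+ r + 2.
have e16 : 1 <= 16 ^+ r :> rat by rewrite exprn_ege1.
have z_gt : 2 * 16 ^+ r < z by rewrite /z; lra.
have z_ge4 : 4 <= z by rewrite /z; lra.
have z_neq0 : z != 0 by apply: lt0r_neq0; lra.
move: z z_gt z_ge4 z_neq0 {e16} => z z_gt z_ge4 z_neq0.
have [X XE] : {X : SL2 {poly rat} | val X = map_mx polyC (mx2 z 1 0 z^-1)}.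
  apply: SL2_of_mx2; first exact: map_mx2.
  by rewrite polyC0 mulr0 subr0 -polyCM mulfV.
have [Y YE] : {Y : SL2 {poly rat} |
    val Y = map_mx polyC (mx2 z 0 0 z^-1) + 'X *: map_mx polyC (delta_mx 1 0)}.
  apply: SL2_of_mx2; first exact: affine_mx2_lower.
  by rewrite mul0r subr0 -polyCM mulfV.
have [szT Tr] := lead_trace_lower _ _ a b _ _ _ _ r_gt0 XE YE.
set T := \tr _ in szT Tr; rewrite !tr_mx2 !mxE /= in Tr.
have zzV_gt : 15 / 4 <= z - z^-1.
  have : z^-1 <= 4^-1 by rewrite lef_pV2 ?posrE; lra.
  by lra.
(* Each of the 2r factors z - 1/z turns one Chebyshev value into z^c - z^-c. *)
have Trz : T`_r * (z - z^-1) ^+ (r + r) =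
    \prod_(i < r) ((z ^ a i - z ^ (- a i)) * (z ^ b i - z ^ (- b i))).
  have -> : (z - z^-1) ^+ (r + r) = \prod_(i < r) ((z - z^-1) * (z - z^-1)).
    by rewrite big_split /= !prodr_const card_ord exprD.
  rewrite Tr -big_split; apply: eq_bigr => i _ /=.
  by rewrite -!chebUz_sumV //; ring.
have Trz_ge : z ^+ N <= 4 ^+ r * `|T`_r * (z - z^-1) ^+ (r + r)|.
  have -> : z ^+ N = 4 ^+ r * \prod_(i < r) (z ^+ `|a i|%N / 2 * (z ^+ `|b i|%N / 2)).
    have {1}-> : 4 ^+ r = \prod_(i < r) (4 : rat) by rewrite prodr_const card_ord.
    rewrite -big_split /N expr_sum; apply: eq_bigr => i _ /=.
    by rewrite exprD; field.
  rewrite ler_pM2l ?exprn_gt0 // Trz normr_prod; apply: ler_prod => i _.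
  rewrite normrM !mulr_ge0 ?exprn_ge0 //=; try lra.
  by apply: ler_pM; rewrite ?abs_exprz_subV_ge ?divr_ge0 ?exprn_ge0 //; lra.
have Tr_neq0 : T`_r != 0.
  apply: contraTneq Trz_ge => ->; rewrite mul0r normr0 mulr0 -ltNge exprn_gt0 //.
  by lra.
have [A [B [AE TE]]] := trace_linear_root _ idfun X Y szT Tr_neq0.
have {TE} TE v : T.[v] = (dickson rat r).[A * v + B].
  rewrite /T TE -[LHS]/(horner_eval v _) rmorph_dickson /=.
  by rewrite /horner_eval hornerD hornerZ hornerX hornerC.
have trX : \tr X = (z + z^-1)%:P by rewrite XE trace_map_mx tr_mx2.
have trY : \tr Y = (z + z^-1)%:P by rewrite YE affine_mx2_lower tr_mx2 polyCD.
have trXY : \tr (X * Y)%g = 'X + (z * z + z^-1 * z^-1)%:P.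
  transitivity (\tr (val X *m val Y)); first by [].
  rewrite XE map_mx2 YE affine_mx2_lower mul_mx2 tr_mx2 polyCD !polyCM; ring.
(* The traces are those of the commuting matrices diag(z, 1/z) and diag(y, 1/y),
   with y = z or y = 1/z. *)
have Tv v y : y != 0 -> y + y^-1 = z + z^-1 -> v = (z * y + z^-1 * y^-1) - (z * z + z^-1 * z^-1) ->
    T.[v] = z ^ E * y ^ D + z ^ (- E) * y ^ (- D).
  move=> y_neq0 yE vE.
  have [X' X'E] : {X' : SL2 rat | val X' = mx2 z 0 0 z^-1}.
    by apply: SL2_of_mx2; [by [] | rewrite mulfV //; ring].
  have [Y' Y'E] : {Y' : SL2 rat | val Y' = mx2 y 0 0 y^-1}.
    by apply: SL2_of_mx2; [by [] | rewrite mulfV //; ring].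
  rewrite -(trace_diag _ _ a b X' Y' z y) // /T !trace_word.
  rewrite -[LHS]/(horner_eval v _) rmorph_mmap; apply: eq_mmap => [k|i] /=.
    by rewrite rmorph_int.
  have trX'Y' : \tr (X' * Y')%g = z * y + z^-1 * y^-1.
    transitivity (\tr (val X' *m val Y')); first by [].
    by rewrite X'E Y'E mul_mx2 tr_mx2; ring.
  rewrite trX trY trXY trX'Y' [\tr X'](congr1 mxtrace X'E) [\tr Y'](congr1 mxtrace Y'E).
  rewrite !tr_mx2 yE /horner_eval !(tnth_nth 0).
  by case: i => [[|[|[|//]]] ?] /=; rewrite ?hornerC // hornerD hornerX hornerC vE subrK.
(* d is the distance between the values of A * 'X + B at the two points. *)
pose d := `|A| * (z - z^-1) ^+ 2.
have d_pow : d ^+ r = `|T`_r * (z - z^-1) ^+ (r + r)|.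
  rewrite /d exprMn -normrX AE -exprM normrM addnn mul2n; congr (_ * _).
  by rewrite ger0_norm ?exprn_ge0 //; lra.
have zN_le : z ^+ N <= 4 ^+ r * d ^+ r by rewrite d_pow.
(* N >= 2r, as no exponent vanishes, so d < 4 would contradict zN_le. *)
have d_ge4 : 4 <= d.
  rewrite leNgt; apply/negP => d_lt4.
  have : z ^+ (r + r) <= z ^+ N.
    apply: ler_weXn2l; first lra.
    rewrite addnn -muln2 -{1}[r]card_ord -sum_nat_const; apply: leq_sum => i _.
    by rewrite (@leq_add 1 1) // absz_gt0.
  apply/negP; rewrite -ltNge; apply: (le_lt_trans zN_le).
  have d_ge0 : 0 <= d by rewrite mulr_ge0 ?sqr_ge0.
  by rewrite -exprMn exprD -exprMn ltrXn2r -?lt0n //; nra.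
have d_le : d <= `|B| + `|A * (- (z - z^-1) ^+ 2) + B|.
  apply: le_trans (ler_normB _ _).
  by rewrite opprD addrCA subrr addr0 mulrN opprK normrM [`|_ ^+ 2|]ger0_norm ?sqr_ge0.
have z_ge1 : 1 <= z by lra.
have [B_ge|B_lt] := leP (d / 2) `|B|.
  left; apply: (dickson_growth _ r _ _ z d B) => //.
  have := TE 0; rewrite mulr0 add0r => <-.
  rewrite (Tv 0 z) ?subrr // -!expfzDr // -opprD.
  exact: abs_exprz_addV_le.
right; apply: (dickson_growth _ r _ _ z d (A * (- (z - z^-1) ^+ 2) + B)) => //.
  by lra.
rewrite -TE (Tv _ z^-1) ?invr_eq0 ?invrK //; last by field.
  rewrite !exprz_inv opprK -!expfzDr // -[- E + D]opprK opprD opprK.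
  exact: abs_exprz_addV_le.
by rewrite addrC.
Qed.

Lemma sum_norm_le :
  \sum_i `|a i| + \sum_i `|b i| <= `|\sum_i a i| + `|\sum_i b i|.
Proof.
have -> : \sum_i `|a i| + \sum_i `|b i| = (\sum_(i < r) (`|a i| + `|b i|))%N%:Z.
  rewrite (big_morph Posz PoszD (erefl _)) -big_split.
  by apply: eq_bigr => i _; rewrite PoszD !abszE.
case: sum_abs_le; rewrite -lez_nat abszE => le_N; apply: (le_trans le_N).
  exact: ler_normD.
exact: ler_normB.
Qed.

Lemma exponents_constant : (forall i j, a i = a j) /\ (forall i j, b i = b j).
Proof.
have a_le := ler_norm_sum (index_enum 'I_r) a xpredT.
have b_le := ler_norm_sum (index_enum 'I_r) b xpredT.
have ab_le := sum_norm_le.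
split; apply: abs_sum_extremal_const => //.
- by move=> i j; rewrite -!abszE (abs_a_eq i j).
- rewrite -(lerD2r (\sum_i `|b i|)); apply: (le_trans ab_le).
  by rewrite lerD2l.
- by move=> i j; rewrite -!abszE (abs_b_eq i j).
- rewrite -(lerD2l (\sum_i `|a i|)); apply: (le_trans ab_le).
  by rewrite lerD2r.
Qed.

End Word.

Theorem corollary2p14 (r : nat) (r_gt0 : (0 < r)%N) (a b : 'I_r -> int)
    (a_neq0 : forall i, a i != 0) (b_neq0 : forall i, b i != 0)
    (w : F2) (w_def : w = (\prod_(i < r) (expgz F2x (a i) * expgz F2y (b i)))%g)
    (f : {mpoly int[3]}) (f_trace : is_trace_poly w f)
    (q : {mpoly rat[3]})
    (f_dickson : map_mpoly intr f = (dickson {mpoly rat[3]} r).[q]) :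
  let i0 := Ordinal r_gt0 in
  w = ((expgz F2x (a i0) * expgz F2y (b i0)) ^+ r)%g.
Proof.
move=> i0; rewrite w_def in f_trace *.
have [a_const b_const] :=
  exponents_constant r r_gt0 a b a_neq0 b_neq0 f q f_trace f_dickson.
rewrite (eq_bigr (fun=> expgz F2x (a i0) * expgz F2y (b i0))%g) => [|i _].
  by rewrite prodg_const card_ord.
by rewrite (a_const i i0) (b_const i i0).
Qed.
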